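(* Every continuous function $\Sigma^\omega\to\mathbb{R}$ that can be computed by a weighted finite automaton can be computed by some average preserving weighted finite automaton. That is, if $\mathcal{A}$ is a WFA over $\Sigma$ whose $\omega$-function $f_{\mathcal{A}}$ is defined on all of $\Sigma^\omega$ and continuous, then there is an average preserving WFA $\mathcal{B}$ over $\Sigma$ with $f_{\mathcal{B}}=f_{\mathcal{A}}$.
   Context: $\Sigma$ is a nonempty finite alphabet; $\Sigma^*$ is the set of finite words, $\Sigma^\omega$ the set of infinite words with the prefix (Cantor) metric $d_C(w,w')=2^{-k}$, where $k$ is the length of the longest common prefix of $w\ne w'$. $\mathrm{pref}_k(w)$ is the prefix of $w$ of length $k$. A weighted finite automaton (WFA) $\mathcal{A}$ over $\Sigma$ with $n\ge 0$ states consists of an initial distribution $I\in\mathbb{R}^{1\times n}$, a final distribution $F\in\mathbb{R}^{n\times 1}$, and weight matrices $A_a\in\mathbb{R}^{n\times n}$, $a\in\Sigma$. For $v=v_1\cdots v_k\in\Sigma^*$ put $A_v=A_{v_1}\cdots A_{v_k}$ (the identity if $v$ is empty). The word function is $F_{\mathcal{A}}(v)=IA_vF$, and the $\omega$-function computed by $\mathcal{A}$ is $f_{\mathcal{A}}(w)=\lim_{k\to\infty}F_{\mathcal{A}}(\mathrm{pref}_k(w))$ for $w\in\Sigma^\omega$ (undefined where the limit does not exist). $\mathcal{A}$ is average preserving if $\sum_{a\in\Sigma}A_aF=|\Sigma|F$. *)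

(* Defs.v *)
From HB Require Import structures.
From mathcomp Require Import all_boot all_order all_algebra.
From mathcomp Require Import all_classical all_reals all_analysis.

Set Implicit Arguments.
Unset Strict Implicit.
Unset Printing Implicit Defensive.

Import Order.TTheory GRing.Theory Num.Theory.
Import numFieldNormedType.Exports.

Local Open Scope classical_set_scope.
Local Open Scope ring_scope.

(* The parameter R does not occur in the body: it is the field in which the
   Cantor metric below takes its values, and makes the metric inferable. *)
Definition infword (R : realType) (S : finType) : Type := nat -> S.

HB.instance Definition _ (R : realType) (S : finType) :=
  gen_eqMixin (infword R S).
HB.instance Definition _ (R : realType) (S : finType) :=
  gen_choiceMixin (infword R S).

Section Cantor.
Context {R : realType} {S : finType}.
Implicit Types (w x y z : infword R S) (k j : nat).

Definition pref k w : seq S := mkseq w k.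

Definition is_lcp_length w w' k : Prop :=
  pref k w = pref k w' /\ forall j, pref j w = pref j w' -> (j <= k)%N.

(* The default value 0 is taken only for w = w', see lcp_lengthP. *)
Definition lcp_length w w' : nat := xget 0%N [set k | is_lcp_length w w' k].

Definition cantor_dist w w' : R :=
  if w == w' then 0 else 2 ^- lcp_length w w'.

Lemma pref_eqP k w w' :
  pref k w = pref k w' <-> (forall i, (i < k)%N -> w i = w' i).
Proof.
split=> [e i ik|e].
  by have := congr1 (fun s => nth (w i) s i) e; rewrite !nth_mkseq.
by apply/eq_in_map => i; rewrite mem_iota add0n => /e.
Qed.

Lemma pref_eq_le j k w w' :
  (j <= k)%N -> pref k w = pref k w' -> pref j w = pref j w'.
Proof.
move=> jk /pref_eqP e; apply/pref_eqP => i ij.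
by apply: e; exact: leq_trans jk.
Qed.

Lemma lcp_lengthP w w' : w <> w' -> is_lcp_length w w' (lcp_length w w').
Proof.
move=> ww'; rewrite /lcp_length.
have ex : exists k, w k != w' k.
  apply: contrapT => h; apply: ww'; apply: funext => i.
  by apply/eqP/negP => /negP h'; apply: h; exists i.
suff [k kP] : exists k, is_lcp_length w w' k.
  exact: (@xgetPex _ 0%N [set k | is_lcp_length w w' k] (ex_intro _ k kP)).
case: (ex_minnP ex) => m m_neq m_min; exists m; split.
  apply/pref_eqP => i im; apply/eqP/negPn/negP => /m_min.
  by rewrite leqNgt im.
move=> j /pref_eqP e; rewrite leqNgt; apply/negP => /e.
by apply/eqP.
Qed.

Lemma cantor_dist_le k w w' :
  cantor_dist w w' <= 2 ^- k <-> pref k w = pref k w'.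
Proof.
rewrite /cantor_dist; case: eqP => [->|ww'].
  by split=> // _; rewrite invr_ge0 exprn_ge0.
have [e m] := lcp_lengthP ww'.
rewrite lef_pV2 ?posrE ?exprn_gt0// ler_eXn2l ?ltr1n//.
by split=> [kl|/m//]; exact: pref_eq_le kl e.
Qed.

Lemma cantor_distxx w : cantor_dist w w = 0.
Proof. by rewrite /cantor_dist eqxx. Qed.

Lemma cantor_dist_positivity w w' : cantor_dist w w' = 0 -> w = w'.
Proof.
rewrite /cantor_dist; case: eqP => // _ /eqP.
by rewrite invr_eq0 expf_eq0 pnatr_eq0 andbF.
Qed.

Lemma cantor_dist_sym w w' : cantor_dist w w' = cantor_dist w' w.
Proof.
rewrite /cantor_dist eq_sym; case: eqP => // _; rewrite /lcp_length.
have lcpC x y k : is_lcp_length x y k -> is_lcp_length y x k.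
  by case=> e m; split=> // j /esym/m.
by congr (2 ^- xget _ _); apply/seteqP; split=> k /=; exact: lcpC.
Qed.

Lemma cantor_dist_ge0 w w' : 0 <= cantor_dist w w'.
Proof.
by rewrite /cantor_dist; case: eqP => // _; rewrite invr_ge0 exprn_ge0.
Qed.

Lemma cantor_dist_triangle y x z :
  cantor_dist x z <= cantor_dist x y + cantor_dist y z.
Proof.
have [->|xy] := pselect (x = y); first by rewrite cantor_distxx add0r.
have [->|yz] := pselect (y = z); first by rewrite cantor_distxx addr0.
have [exy _] := lcp_lengthP xy; have [eyz _] := lcp_lengthP yz.
have dE u v : u <> v -> 2 ^- lcp_length u v = cantor_dist u v.
  by move=> /eqP/negPf uv; rewrite /cantor_dist uv.
have [le|/ltnW le] := leqP (lcp_length x y) (lcp_length y z).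
- apply: (@le_trans _ _ (cantor_dist x y)); last by rewrite lerDl cantor_dist_ge0.
  by rewrite -(dE _ _ xy); apply/cantor_dist_le; rewrite exy; exact: pref_eq_le le eyz.
- apply: (@le_trans _ _ (cantor_dist y z)); last by rewrite lerDr cantor_dist_ge0.
  by rewrite -(dE _ _ yz); apply/cantor_dist_le; rewrite -eyz; exact: pref_eq_le le exy.
Qed.

End Cantor.

HB.instance Definition _ (R : realType) (S : finType) :=
  @isMetric.Build R (infword R S) (@cantor_dist R S)
    cantor_distxx cantor_dist_positivity cantor_dist_sym cantor_dist_triangle.

Record wfa (R : realType) (S : finType) := Wfa {
  nstates : nat ;
  init : 'rV[R]_nstates ;
  final : 'cV[R]_nstates ;
  weight : S -> 'M[R]_nstates }.

Section WFA.
Context {R : realType} {S : finType}.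
Implicit Type A : wfa R S.

Definition word_weight A (v : seq S) : 'M[R]_(nstates A) :=
  \prod_(a <- v) weight A a.

Definition word_fun A (v : seq S) : R :=
  (init A *m word_weight A v *m final A) 0 0.

Definition omega_defined A (w : infword R S) : Prop :=
  cvgn (fun k => word_fun A (pref k w)).

(* Meaningful at w only when omega_defined A w: limits are total here. *)
Definition omega_fun A (w : infword R S) : R :=
  limn (fun k => word_fun A (pref k w)).

Definition average_preserving A : Prop :=
  \sum_(a : S) weight A a *m final A = #|S|%:R *: final A.

End WFA.

(* Main.v *)
Require Import Defs.
From HB Require Import structures.
From mathcomp Require Import all_boot all_order all_algebra.
From mathcomp Require Import all_classical all_reals all_analysis.

Set Implicit Arguments.
Unset Strict Implicit.
Unset Printing Implicit Defensive.

Import Order.TTheory GRing.Theory Num.Theory.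
Import numFieldNormedType.Exports.
Local Open Scope classical_set_scope.
Local Open Scope ring_scope.

(** Let f be the function of A. For a row vector x write f_x for the function
of A with x as initial distribution; the x for which f_x is total and
uniformly continuous form a subspace U that contains I and is stable under
every A_a, with f_(x A_a) (w) = f_x (a w). The mean L x of f_x for the uniform
Bernoulli measure is a linear functional on U, and
sum_a L (x A_a) = |S| L x. After projecting onto U, the functional L is
given by a column vector, which is the final distribution sought: the new
automaton sends a word v to the mean of f over the cylinder v S^omega, and
by uniform continuity these means converge to f along the prefixes of any
infinite word. *)

(** * Infinite words and uniform continuity *)

Section Words.
Context {R : realType} {S : finType}.
Implicit Types (w : infword R S) (a : S) (v : seq S).

Definition iw_cons a w : infword R S := fun i => if i is j.+1 then w j else a.

Definition iw_tail w : infword R S := fun i => w i.+1.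

Definition iw_cat v w : infword R S := foldr iw_cons w v.

Lemma iw_consK w : iw_cons (w 0%N) (iw_tail w) = w.
Proof. by apply: funext => -[]. Qed.

Lemma pref_iw_cons k a w : pref k.+1 (iw_cons a w) = a :: pref k w.
Proof. by rewrite /pref /mkseq /= -[1%N]addn0 iotaDl -map_comp. Qed.

Lemma pref_iw_cat v w : pref (size v) (iw_cat v w) = v.
Proof. by elim: v => [|a v IH] //=; rewrite pref_iw_cons IH. Qed.

Lemma iw_cat_rcons v a w : iw_cat (rcons v a) w = iw_cat v (iw_cons a w).
Proof. by rewrite /iw_cat -cats1 foldr_cat. Qed.

(** Uniform continuity for the Cantor metric: by [cantor_dist_le], agreeing on [K] letters means
    lying within distance 2^-K. *)
Definition prefix_uniform (g : infword R S -> R) : Prop :=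
  forall e, 0 < e -> exists K, forall w w',
    pref K w = pref K w' -> `|g w - g w'| <= e.

Lemma prefix_uniform_cons a g :
  prefix_uniform g -> prefix_uniform (fun w => g (iw_cons a w)).
Proof.
move=> gu e e0; have [K KP] := gu e e0; exists K => w w' ww'.
by apply: KP; apply: (@pref_eq_le _ _ K K.+1) => //; rewrite !pref_iw_cons ww'.
Qed.

Lemma prefix_uniformD g h : prefix_uniform g -> prefix_uniform h ->
  prefix_uniform (fun w => g w + h w).
Proof.
move=> gu hu e e0; have e20 : 0 < e / 2 by rewrite divr_gt0.
have [K KP] := gu _ e20; have [J JP] := hu _ e20.
exists (maxn K J) => w w' ww'; rewrite opprD addrACA [leRHS]splitr.
rewrite (le_trans (ler_normD _ _))// lerD//.
- by apply: KP; exact: pref_eq_le (leq_maxl K J) ww'.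
- by apply: JP; exact: pref_eq_le (leq_maxr K J) ww'.
Qed.

Lemma prefix_uniformZ (c : R) g : prefix_uniform g ->
  prefix_uniform (fun w => c * g w).
Proof.
(* The added 1 keeps the divisor positive when [c] is 0. *)
move=> gu e e0; have c0 : 0 < `|c| + 1 by rewrite ltr_wpDl.
have [K KP] := gu (e / (`|c| + 1)) (divr_gt0 e0 c0).
exists K => w w' /KP ww'; rewrite -mulrBr normrM.
rewrite (@le_trans _ _ ((`|c| + 1) * `|g w - g w'|))//.
  by rewrite ler_wpM2r// lerDl.
by rewrite mulrC -ler_pdivlMr.
Qed.

(* König's lemma: if uniformity fails below v then it fails below some
   one-letter extension of v, which produces an infinite word at which g is
   not continuous. *)
Lemma continuous_prefix_uniform (g : infword R S -> R) :
  continuous g -> prefix_uniform g.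
Proof.
move=> gc e e0.
pose good v := exists K, forall w w', pref K w = pref K w' ->
  `|g (iw_cat v w) - g (iw_cat v w')| <= e.
suff : good [::] by case=> K KP; exists K => w w' /KP.
apply: contrapT => bad0.
have step v : exists a, ~ good v -> ~ good (rcons v a).
  have [gv|bv] := pselect (good v).
    have [a _] : exists a : S, True; last by exists a.
    (* Over an empty alphabet there is no infinite word, so [good [::]] would hold vacuously. *)
    apply: contrapT => noS; apply: bad0; exists 0%N => w.
    by exfalso; apply: noS; exists (w 0%N).
  apply: contrapT => h.
  have {}h a : good (rcons v a).
    by apply: contrapT => ba; apply: h; exists a.
  have [K KP] := choice h; apply: bv.
  (* The alphabet is finite, so one bound serves all letters; the successor accounts for the first
     letter. *)
  exists (\max_a K a).+1 => w w'.
  rewrite -(iw_consK w) -(iw_consK w') !pref_iw_cons => -[<- ww'].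
  rewrite -!iw_cat_rcons; apply: KP.
  exact: pref_eq_le (leq_bigmax (w 0%N)) ww'.
have [next nextP] := choice step.
pose s n := iter n (fun v => rcons v (next v)) [::].
have bads n : ~ good (s n) by elim: n => //= n; exact: nextP.
pose w : infword R S := fun i => next (s i).
have prefs n : pref n w = s n.
  by elim: n => // n IH; rewrite /pref mkseqS -/(pref n w) IH.
have e20 : 0 < e / 2 by rewrite divr_gt0.
have /cvgrPdist_le/(_ _ e20) := gc w.
rewrite -filter_from_ballE => -[d /= d0 dP].
have [n nd] : exists n, 2 ^- n < d.
  have /cvgrPdist_lt/(_ _ d0)[n _ /(_ n (leqnn n))] :
      (fun n => (2^-1 : R) ^+ n) @ \oo --> (0 : R).
    by apply: cvg_expr; rewrite gtr0_norm ?invr_gt0// invf_lt1 ?ltr1n.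
  by rewrite sub0r normrN ger0_norm ?exprn_ge0 ?invr_ge0// exprVn => h; exists n.
have near u : `|g w - g (iw_cat (pref n w) u)| <= e / 2.
  apply: dP; apply: le_lt_trans nd.
  apply/cantor_dist_le.
  by have := pref_iw_cat (pref n w) u; rewrite size_mkseq.
(* Length 0 is enough: for this [n], [g] is within e/2 of [g w] on the whole cylinder of [s n]. *)
apply: (bads n); exists 0%N => u u' _; rewrite -prefs.
rewrite [leRHS]splitr (le_trans (ler_distD (g w) _ _))// lerD//.
by rewrite distrC.
Qed.

(** * The mean for the uniform Bernoulli measure *)

Context (S_gt0 : (0 < #|S|)%N).

(** The [k]-th iterate at [w] is the mean of g(v w) over all words v of length [k]. *)
Definition avg (g : infword R S -> R) w : R :=
  #|S|%:R^-1 * \sum_(a : S) g (iw_cons a w).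

(* On uniformly continuous g the limit does not depend on the base word. *)
Let base : infword R S := fun _ => enum_val (Ordinal S_gt0).

Definition mean (g : infword R S -> R) : R :=
  limn (fun k => iter k avg g base).

Lemma avg_dist_le (g h : infword R S -> R) w w' (e : R) :
  (forall a, `|g (iw_cons a w) - h (iw_cons a w')| <= e) ->
  `|avg g w - avg h w'| <= e.
Proof.
move=> gh; have S0 : 0 < #|S|%:R :> R by rewrite ltr0n.
rewrite -mulrBr normrM gtr0_norm ?invr_gt0// ler_pdivrMl// -sumrB.
rewrite (le_trans (ler_norm_sum _ _ _))// mulr_natl -sumr_const.
exact: ler_sum.
Qed.

Lemma avg_cst (c : R) w : avg (fun _ => c) w = c.
Proof.
by rewrite /avg sumr_const -[c *+ _]mulr_natl mulKf// pnatr_eq0 -lt0n.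
Qed.

Lemma iter_avg_dist_le (g : infword R S -> R) (c e : R) k w :
  (forall u, `|g u - c| <= e) -> `|iter k avg g w - c| <= e.
Proof.
move=> gc; elim: k w => //= k IH w.
by rewrite -[c](avg_cst c w); apply: avg_dist_le.
Qed.

(** Each averaging consumes one letter of the prefix on which the arguments must agree; after [K]
    rounds nothing is required of them. *)
Lemma iter_avg_osc (g : infword R S -> R) K (e : R) :
  (forall w w', pref K w = pref K w' -> `|g w - g w'| <= e) ->
  forall w w', `|iter K avg g w - iter K avg g w'| <= e.
Proof.
elim: K g => [|K IH] g gK w w'; first exact: gK.
rewrite iterSr; apply: IH => u u' uu'; apply: avg_dist_le => a.
by apply: gK; rewrite !pref_iw_cons uu'.
Qed.

(** By [iter_avg_osc] some iterate is nearly constant, and further averaging keeps it near that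
    constant, so the sequence is Cauchy. *)
Lemma mean_cvg g : prefix_uniform g ->
  (fun k => iter k avg g base) @ \oo --> mean g.
Proof.
move=> gu; suff: cvgn (fun k => iter k avg g base) by [].
apply/cauchy_cvgP/cauchy_exP => e e0.
have e20 : 0 < e / 2 by rewrite divr_gt0.
have [K KP] := gu (e / 2) e20.
have near k : (K <= k)%N ->
    `|iter k avg g base - iter K avg g base| <= e / 2.
  move=> Kk; rewrite -(subnK Kk) iterD.
  by apply: iter_avg_dist_le => u; exact: iter_avg_osc.
exists (iter K avg g base); exists K => // k /near kK /=.
rewrite -ball_normE /= distrC (le_lt_trans kK)// ltr_pdivrMr// ltr_pMr//.
by rewrite ltr1n.
Qed.

Lemma mean_dist_le (g : infword R S -> R) (c e : R) : prefix_uniform g ->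
  (forall u, `|g u - c| <= e) -> `|mean g - c| <= e.
Proof.
move=> gu gc.
have cv : (fun k => `|iter k avg g base - c|) @ \oo --> `|mean g - c|.
  by apply: cvg_norm; apply: cvgB; [exact: mean_cvg | exact: cvg_cst].
rewrite -(cvg_lim _ cv)//; apply: limr_le; first exact: cvgP cv.
by near=> k; exact: iter_avg_dist_le.
Unshelve. all: by end_near. Qed.

Lemma mean_avg g : prefix_uniform g -> mean (avg g) = mean g.
Proof.
move=> gu; apply: cvg_lim => //.
have := mean_cvg gu; rewrite -cvg_shiftS.
by under eq_fun do rewrite iterSr.
Qed.

Lemma meanD g h : prefix_uniform g -> prefix_uniform h ->
  mean (fun w => g w + h w) = mean g + mean h.
Proof.
move=> gu hu; apply: cvg_lim => //.
have -> : (fun k => iter k avg (fun w => g w + h w) base) =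
    (fun k => iter k avg g base + iter k avg h base).
  apply: funext => k; elim: k base => //= k IH w.
  rewrite [LHS]/avg (eq_bigr _ (fun a _ => IH (iw_cons a w))).
  by rewrite big_split mulrDr.
by apply: cvgD; exact: mean_cvg.
Qed.

Lemma meanZ (c : R) g : prefix_uniform g ->
  mean (fun w => c * g w) = c * mean g.
Proof.
move=> gu; apply: cvg_lim => //.
have -> : (fun k => iter k avg (fun w => c * g w) base) =
    (fun k => c * iter k avg g base).
  apply: funext => k; elim: k base => //= k IH w.
  rewrite [LHS]/avg (eq_bigr _ (fun a _ => IH (iw_cons a w))).
  by rewrite -mulr_sumr mulrCA.
by apply: cvgM; [exact: cvg_cst | exact: mean_cvg].
Qed.

(** Uniformity is carried through the induction because [meanD] asks for it on the tail of the
    sum. *)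
Lemma mean_sum (I : Type) (r : seq I) (h : I -> infword R S -> R) :
  (forall i, prefix_uniform (h i)) ->
  prefix_uniform (fun w => \sum_(i <- r) h i w) /\
  mean (fun w => \sum_(i <- r) h i w) = \sum_(i <- r) mean (h i).
Proof.
move=> hu; elim: r => [|i r [IHu IH]].
  have -> : (fun w => \sum_(i <- [::]) h i w) = (fun=> 0).
    by apply: funext => w; rewrite big_nil.
  have u0 : prefix_uniform (fun=> 0).
    by move=> e e0; exists 0%N => w w' _; rewrite subrr normr0 ltW.
  split=> //; rewrite big_nil; apply/eqP.
  rewrite -subr_eq0 -normr_le0 mean_dist_le// => u.
  by rewrite subrr normr0.
have -> : (fun w => \sum_(j <- i :: r) h j w) =
    (fun w => h i w + \sum_(j <- r) h j w).
  by apply: funext => w; rewrite big_cons.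
split; first exact: prefix_uniformD.
by rewrite meanD// big_cons IH.
Qed.

(** The source of average preservation: the left side is |S| times the mean of [avg g], and
    averaging leaves the mean unchanged. *)
Lemma sum_mean_cons g : prefix_uniform g ->
  \sum_(a : S) mean (fun w => g (iw_cons a w)) = #|S|%:R * mean g.
Proof.
move=> gu; rewrite -[in RHS](mean_avg gu).
have [su <-] := mean_sum (index_enum S)
  (fun a => prefix_uniform_cons a gu).
by rewrite meanZ// mulVKf// pnatr_eq0 -lt0n.
Qed.

End Words.

(** * Subspaces cut out by a predicate *)

(* M is a matrix of maximal rank among those whose row space satisfies P. *)
Lemma linear_pred_rowspace (F : fieldType) n (P : 'rV[F]_n -> Prop) :
  P 0 -> (forall c x y, P x -> P y -> P (c *: x + y)) ->
  exists M : 'M[F]_n, forall x, P x <-> (x <= M)%MS.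
Proof.
move=> P0 Plin.
pose Q r := `[< exists M : 'M[F]_n,
  \rank M = r /\ forall x : 'rV_n, (x <= M)%MS -> P x >].
have Q0 : exists r, Q r.
  exists 0%N; apply/asboolP; exists 0; split; first exact: mxrank0.
  by move=> x; rewrite submx0 => /eqP ->.
have Qn r : Q r -> (r <= n)%N.
  by move=> /asboolP[M [<- _]]; exact: rank_leq_row.
case: (ex_maxnP Q0 Qn) => r /asboolP[M [rM MP]] rmax.
exists M => x; split; last exact: MP.
(* The row space of [M + x] still satisfies [P], so maximality of the rank makes it equal to that of
   [M]. *)
move=> Px; apply: submx_trans (addsmxSr M x) _.
rewrite -(mxrank_leqif_sup (addsmxSl M x)) eqn_leq mxrankS ?addsmxSl//=.
rewrite rM; apply: rmax; apply/asboolP; exists (M + x)%MS; split=> // y.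
move=> /sub_addsmxP[[u1 u2] /= ->]; rewrite [u2]mx11_scalar mul_scalar_mx addrC.
by apply: Plin => //; apply: MP; exact: submxMl.
Qed.

(** * The subspace of regular initial distributions *)

Section StateFunctions.
Context {R : realType} {S : finType} (A : wfa R S).
Implicit Types (x y : 'rV[R]_(nstates A)) (w : infword R S) (v : seq S).

Definition state_fun x v : R := (x *m word_weight A v *m final A) 0 0.

Definition state_omega x w : R := limn (fun k => state_fun x (pref k w)).

(** The subspace U, as a predicate. Convergence is stated separately because [limn] is total. *)
Definition regular_state x : Prop :=
  (forall w, cvgn (fun k => state_fun x (pref k w))) /\
  prefix_uniform (state_omega x).

Lemma state_fun_cons x a v : state_fun x (a :: v) = state_fun (x *m weight A a) v.
Proof. by rewrite /state_fun /word_weight big_cons mulmxA. Qed.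

Lemma regular_state_cvg x w : regular_state x ->
  (fun k => state_fun x (pref k w)) @ \oo --> state_omega x w.
Proof. by case=> xc _; exact: xc. Qed.

Lemma state_fun_step_cvg x a w : regular_state x ->
  (fun k => state_fun (x *m weight A a) (pref k w)) @ \oo -->
  state_omega x (iw_cons a w).
Proof.
move=> xr; have := regular_state_cvg xr (w := iw_cons a w); rewrite -cvg_shiftS.
by under eq_fun do rewrite pref_iw_cons state_fun_cons.
Qed.

Lemma state_omega_step x a : regular_state x ->
  state_omega (x *m weight A a) = fun w => state_omega x (iw_cons a w).
Proof.
by move=> xr; apply: funext => w; apply: cvg_lim => //; exact: state_fun_step_cvg.
Qed.

Lemma regular_state_step x a : regular_state x -> regular_state (x *m weight A a).
Proof.
move=> xr; split=> [w|].
  by apply: cvgP; exact: state_fun_step_cvg.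
by rewrite state_omega_step//; apply: prefix_uniform_cons; case: xr.
Qed.

(** Reading [v] restricts the function of [x] to the cylinder of [v], one letter at a time. *)
Lemma state_omega_word x v : regular_state x ->
  regular_state (x *m word_weight A v) /\
  state_omega (x *m word_weight A v) = fun w => state_omega x (iw_cat v w).
Proof.
elim: v x => [|a v IH] x xr; first by rewrite /word_weight big_nil mulmx1.
rewrite /word_weight big_cons mulmxA.
have [? ->] := IH _ (regular_state_step a xr); split=> //.
by apply: funext => w; rewrite state_omega_step.
Qed.

Lemma state_fun_linear_cvg (c : R) x y w : regular_state x -> regular_state y ->
  (fun k => state_fun (c *: x + y) (pref k w)) @ \oo -->
  c * state_omega x w + state_omega y w.
Proof.
move=> xr yr.
have -> : (fun k => state_fun (c *: x + y) (pref k w)) =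
    (fun k => c * state_fun x (pref k w) + state_fun y (pref k w)).
  by apply: funext => k; rewrite /state_fun !mulmxDl -!scalemxAl !mxE.
apply: cvgD; last exact: regular_state_cvg.
by apply: cvgM; [exact: cvg_cst | exact: regular_state_cvg].
Qed.

Lemma state_omega_linear (c : R) x y : regular_state x -> regular_state y ->
  state_omega (c *: x + y) = fun w => c * state_omega x w + state_omega y w.
Proof.
move=> xr yr; apply: funext => w; apply: cvg_lim => //.
exact: state_fun_linear_cvg.
Qed.

Lemma regular_state_linear (c : R) x y : regular_state x -> regular_state y ->
  regular_state (c *: x + y).
Proof.
move=> xr yr; split=> [w|].
  by apply: cvgP; exact: state_fun_linear_cvg.
rewrite state_omega_linear//; case: xr yr => _ xu [_ yu].
by apply: prefix_uniformD => //; exact: prefix_uniformZ.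
Qed.

Lemma regular_state0 : regular_state 0.
Proof.
have s0 : state_fun 0 = fun=> 0.
  by apply: funext => v; rewrite /state_fun !mul0mx mxE.
have o0 : state_omega 0 = fun=> 0.
  by apply: funext => w; rewrite /state_omega s0; exact: lim_cst.
split=> [w|]; first by rewrite s0; exact: is_cvg_cst.
by rewrite o0 => e e0; exists 0%N => w w' _; rewrite subrr normr0 ltW.
Qed.

End StateFunctions.

Arguments state_omega {R S} A x w.
Arguments regular_state {R S} A x.

(** * The average preserving automaton *)

Theorem corollary20 (R : realType) (S : finType) (S_nonempty : (0 < #|S|)%N)
    (A : wfa R S)
    (A_total : forall w : infword R S, omega_defined A w)
    (A_cont : continuous (omega_fun A)) :
  exists B : wfa R S,
    average_preserving B /\
    (forall w : infword R S, omega_defined B w) /\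
    (forall w : infword R S, omega_fun B w = omega_fun A w).
Proof.
pose n := nstates A; pose I := init A.
have Ir : regular_state A I by split=> //; exact: continuous_prefix_uniform.
have [M MP] := linear_pred_rowspace (regular_state0 A)
  (@regular_state_linear _ _ A).
(* A projection onto U: it fixes regular vectors and sends every vector to a regular one. *)
pose proj : 'M[R]_n := pinvmx M *m M.
have projP x : (x <= M)%MS -> x *m proj = x.
  by move=> xM; rewrite mulmxA mulmxKpV.
have proj_reg (x : 'rV_n) : regular_state A (x *m proj).
  by apply/MP; rewrite mulmxA submxMl.
pose L (x : 'rV_n) := mean S_nonempty (state_omega A x).
have L_lin (c : R) x y : regular_state A x -> regular_state A y ->
    L (c *: x + y) = c * L x + L y.
  move=> xr yr; rewrite /L state_omega_linear// meanD ?meanZ//.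
  - by case: xr.
  - by apply: prefix_uniformZ; case: xr.
  - by case: yr.
have L0 : L 0 = 0.
  have := L_lin (-1) 0 0 (regular_state0 A) (regular_state0 A).
  by rewrite scaler0 addr0 mulN1r addNr.
(* The coordinates of the functional sending x to [L (x *m proj)], which extends [L] from U to the
   whole space. *)
pose F : 'cV[R]_n := \col_i L (row i proj).
have LE x : regular_state A x -> x *m F = (L x)%:M.
  move=> /MP/projP xE; apply/matrixP => i j; rewrite !ord1 !mxE mulr1n -[in RHS]xE.
  rewrite [in RHS]mulmx_sum_row.
  suff [_ ->] : regular_state A (\sum_i x 0 i *: row i proj) /\
      L (\sum_i x 0 i *: row i proj) = \sum_i x 0 i * L (row i proj).
    by apply: eq_bigr => k _; rewrite !mxE.
  (* [L] is known to be linear only on U, so partial sums must be kept regular. *)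
  apply: (big_ind2 (fun u l => regular_state A u /\ L u = l)).
  - by split=> //; exact: regular_state0.
  - move=> u l u' l' [ur <-] [u'r <-].
    rewrite -[u]scale1r; split; first exact: regular_state_linear.
    by rewrite L_lin// mul1r scale1r.
  - move=> k _; have kr : regular_state A (row k proj).
      by rewrite -[proj]mul1mx row_mul; exact: proj_reg.
    rewrite -[_ *: _]addr0; split.
      by apply: regular_state_linear => //; exact: regular_state0.
    by rewrite L_lin ?L0 ?addr0//; exact: regular_state0.
(* Projecting first changes no run from a regular vector, and it makes average preservation hold on
   every row, including rows outside U. *)
pose B := @Wfa R S n I F (fun a => proj *m weight A a).
have BE v : word_fun B v = L (I *m word_weight A v).
  have [Ivr _] := state_omega_word v Ir.
  rewrite /word_fun /=.
  suff wE (x : 'rV_n) : regular_state A x ->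
      x *m word_weight B v = x *m word_weight A v.
    by rewrite wE// LE// mxE eqxx mulr1n.
  elim: v x {Ivr} => [|a v IH] x xr; first by rewrite /word_weight !big_nil.
  have /MP/projP xE := xr.
  have -> : word_weight B (a :: v) = proj *m weight A a *m word_weight B v.
    by rewrite /word_weight big_cons.
  have -> : word_weight A (a :: v) = weight A a *m word_weight A v.
    by rewrite /word_weight big_cons.
  rewrite mulmxA (mulmxA x proj) xE (IH _ (regular_state_step a xr)).
  by rewrite -mulmxA.
have B_cvg w : (fun k => word_fun B (pref k w)) @ \oo --> omega_fun A w.
  apply/cvgrPdist_le => e e0.
  have [_ /(_ e e0)[K KP]] := Ir.
  (* [word_fun B (pref k w)] is the mean of f over a cylinder whose words agree with [w] on [K]
     letters. *)
  exists K => // k /= Kk; rewrite BE distrC.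
  have [[_ Ivu] IvE] := state_omega_word (pref k w) Ir.
  apply: mean_dist_le => // u; rewrite IvE; apply: KP.
  apply: (pref_eq_le Kk).
  by have := pref_iw_cat (pref k w) u; rewrite size_mkseq.
exists B; split; last first.
  by split=> w; [exact: cvgP (B_cvg w) | exact: cvg_lim (B_cvg w)].
(* Row by row, the identity becomes [sum_mean_cons] for the function of the regular vector
   [row i proj]. *)
apply/row_matrixP => i; rewrite linear_sum /= linearZ /=.
have ir : regular_state A (row i proj).
  by rewrite -[proj]mul1mx row_mul; exact: proj_reg.
have -> : row i F = (L (row i proj))%:M.
  by apply/matrixP => k l; rewrite !ord1 !mxE mulr1n.
have [_ iu] := ir.
rewrite scale_scalar_mx -sum_mean_cons// raddf_sum /=.
apply: eq_bigr => a _; rewrite row_mul row_mul LE; last exact: regular_state_step.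
by rewrite /L state_omega_step.
Qed.
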